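(* Let $n\ge 1$, let $C = (1,\sigma_2, \ldots, \sigma_{2n+1}) \in \mathcal{IC}_{2n+1}$, and let $\sigma_C = 1 \sigma_2 \ldots \sigma_{2n+1}\in S_{2n+1}$ (one-line notation). If $NT_{\mu}(C) = n$, then the charge path of $\sigma_C$ is a Dyck path (of length $2n$).
   Context: Charge path: for a permutation $\sigma=\sigma_1\ldots\sigma_m\in S_m$ in one-line notation, define the index $\mathrm{ind}_\sigma$ by $\mathrm{ind}_\sigma(1)=0$ and, inductively, $\mathrm{ind}_\sigma(i+1)=\mathrm{ind}_\sigma(i)$ if $i+1$ appears to the right of $i$ in $\sigma$, and $\mathrm{ind}_\sigma(i+1)=1+\mathrm{ind}_\sigma(i)$ if $i+1$ appears to the left of $i$ in $\sigma$. The charge path of $\sigma$ is the path whose successive vertices are $(i-1,\mathrm{ind}_\sigma(\sigma_i))$ for $i=1,\dots,m$, with consecutive vertices joined by edges. A Dyck path of length $2n$ is a lattice path with steps $(1,1)$ and $(1,-1)$ from $(0,0)$ to $(2n,0)$ that never goes below the $x$-axis. Cycles: an $m$-cycle of $\{1,\dots,m\}$ is written $C=(c_0,\dots,c_{m-1})$ with $c_0=1$ and read cyclically from left to right. We say $c_s$ is cyclically between $c_i$ and $c_j$ if $i<s<j$, or $j<i<s$, or $s<j<i$. For $a<b$, the pair $\langle a,b\rangle$ is an occurrence of $\mu$ in $C$ if there is no $x$ with $a<x<b$ that is cyclically between $a$ and $b$ in $C$; it is nontrivial if $a+1<b$. $NT_\mu(C)$ is the number of nontrivial occurrences of $\mu$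 in $C$. The cycle $C$ is incontractible if there is no $i$ with $1\le i\le m-1$ such that $i+1$ immediately follows $i$ in $C$; $\mathcal{IC}_m$ is the set of incontractible $m$-cycles in $S_m$. *)

(* Defs.v *)
From mathcomp Require Import all_boot all_order all_algebra all_fingroup.

Set Implicit Arguments.
Unset Strict Implicit.
Unset Printing Implicit Defensive.

(* Letters and positions are 0-based: the letter i + 1 of {1, ..., m} is the
   element i of 'I_m, so that the letter 1 is ord0; likewise sigma_(i+1) is
   s i. *)

Definition full_cycle (m : nat) (C : 'S_m) : bool := porbits C == [set [set: 'I_m]].

Definition incontractible (m : nat) (C : 'S_m) : bool :=
  [forall i : 'I_m, (i.+1 < m) ==> (C i != i.+1 :> nat)].

Definition IC (m : nat) : {set 'S_m} :=
  [set C : 'S_m | full_cycle C && incontractible C].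

(* C = (c_0, ..., c_k) with k + 1 = m and c_0 = 1. *)
Definition cyc (k : nat) (C : 'S_k.+1) (i : nat) : 'I_k.+1 := (C ^+ i)%g ord0.

Definition cyc_between (k : nat) (C : 'S_k.+1) (a x b : 'I_k.+1) : bool :=
  [exists i : 'I_k.+1, exists s : 'I_k.+1, exists j : 'I_k.+1,
    [&& a == cyc C i, x == cyc C s, b == cyc C j
      & [|| i < s < j, j < i < s | s < j < i]]].

Definition mu_occ (k : nat) (C : 'S_k.+1) (a b : 'I_k.+1) : bool :=
  (a < b) && [forall x : 'I_k.+1, (a < x < b) ==> ~~ cyc_between C a x b].

Definition NT_mu (k : nat) (C : 'S_k.+1) : nat :=
  #|[set p : 'I_k.+1 * 'I_k.+1 | mu_occ C p.1 p.2 && (p.1.+1 < p.2)]|.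

Lemma cyc_inj (k : nat) (C : 'S_k.+1) :
  full_cycle C -> injective (fun i : 'I_k.+1 => cyc C i).
Proof.
move=> /eqP hC.
have h0 : porbit C ord0 = setT.
  by apply/set1P; rewrite -hC; apply/imsetP; exists ord0.
have hs : #|porbit C ord0| = k.+1 by rewrite h0 cardsT card_ord.
have := uniq_traject_porbit C ord0; rewrite hs => hu i j eij.
apply: val_inj; apply/eqP.
rewrite -(nth_uniq ord0 _ _ hu) ?size_traject ?ltn_ord //.
rewrite !nth_traject ?ltn_ord // -!permX.
by apply/eqP.
Qed.

Lemma IC_full_cycle (m : nat) (C : 'S_m) : C \in IC m -> full_cycle C.
Proof. by rewrite inE => /andP[]. Qed.

(* sigma_C: the permutation whose one-line notation is c_0 c_1 ... c_k. *)
Definition sigma_of (k : nat) (C : 'S_k.+1) (hC : C \in IC k.+1) : 'S_k.+1 :=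
  perm (cyc_inj (IC_full_cycle hC)).

(* ind s j is the index of the letter j + 1; s^-1 sends a letter to its
   position in the one-line notation of s. *)
Fixpoint ind (k : nat) (s : 'S_k.+1) (j : nat) : nat :=
  if j is i.+1 then
    let pos (a : nat) : 'I_k.+1 := (s^-1)%g (inord a) in
    if pos i < pos i.+1 then ind s i else (ind s i).+1
  else 0.

(* A lattice path is given by the sequence of its vertices. *)
Definition charge_path (k : nat) (s : 'S_k.+1) : seq (int * int) :=
  [seq (Posz (val i), Posz (ind s (s i))) | i <- enum 'I_k.+1].

Definition dyck_step (u v : int * int) : bool :=
  ((v == (u.1 + 1, u.2 + 1)) || (v == (u.1 + 1, u.2 - 1)))%R.

Definition dyck_path (n : nat) (p : seq (int * int)) : bool :=
  if p is v :: q then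
    [&& v == (0%R, 0%R), path dyck_step v q, last v q == (Posz (2 * n), 0%R)
      & all (fun w : int * int => 0 <= w.2)%R p]
  else false.

(* Main.v *)
(* Call the arc from i to i + 1 the part of the cycle read rightwards from i to
   i + 1.  In an incontractible cycle this arc is never empty; a letter > i + 1
   on it yields a nontrivial occurrence <i, _>, a letter < i on it yields a
   nontrivial occurrence <_, i + 1>.  So each of the 2n values of i is covered by
   an occurrence, and an occurrence <a, b> covers only a and b - 1.  With n
   occurrences each i is covered exactly once, hence no arc contains both smaller
   and larger letters.
     The index of j counts the arcs from i to i + 1 with i < j that jump over the
   cut in front of 1.  Replacing this cut by any other one changes the count
   between two letters only by boundary terms.  For adjacent letters x y of C,
   use the cut between them: if x < y, it is crossed exactly by the arcs of x and
   of y - 1 among those with x <= i < y; if x > y, by none with y <= i < x.  This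
   gives steps +1 and -1 respectively, and, for the last letter and the cut in
   front of 1 itself, final height 0. *)

Require Import Defs.
From mathcomp Require Import all_boot all_order all_algebra all_fingroup.
From mathcomp Require Import zify.

Set Implicit Arguments.
Unset Strict Implicit.
Unset Printing Implicit Defensive.

(** * Positions of letters and crossings of a cut *)

Definition pos (k : nat) (s : 'S_k.+1) (a : nat) : nat := (s^-1)%g (inord a).

Definition btw (i s j : nat) : bool := [|| i < s < j, j < i < s | s < j < i].

Lemma ltn_pos (k : nat) (s : 'S_k.+1) (a : nat) : pos s a < k.+1.
Proof. exact: ltn_ord. Qed.

Lemma pos_perm (k : nat) (s : 'S_k.+1) (i : 'I_k.+1) : pos s (s i) = i.
Proof. by rewrite /pos inord_val permK. Qed.

Lemma pos_inj (k : nat) (s : 'S_k.+1) (a b : nat) :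
  a <= k -> b <= k -> pos s a = pos s b -> a = b.
Proof.
move=> ak bk /val_inj /perm_inj /(congr1 val).
by rewrite /= !inordK.
Qed.

(** The arc from [i] to [i.+1] passes the cut in front of position [t]; the three cases are the
    rotations of one cyclic order. *)
Definition crosses (k : nat) (s : 'S_k.+1) (t i : nat) : bool :=
  [|| pos s i < t <= pos s i.+1, t <= pos s i.+1 <= pos s i
    | pos s i.+1 <= pos s i < t].

Lemma indS (k : nat) (s : 'S_k.+1) (i : nat) :
  ind s i.+1 = (pos s i.+1 <= pos s i) + ind s i.
Proof. by rewrite /= -/(pos s i) -/(pos s i.+1); case: ltnP. Qed.

(* The number of times the walk a, a + 1, ..., b around the cycle crosses the
   cut before position t does not depend on t, up to the endpoints. *)
Lemma sum_crosses (k : nat) (s : 'S_k.+1) (t a b : nat) : a <= b ->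
  \sum_(a <= i < b) crosses s t i + ind s a + (t <= pos s a) =
  ind s b + (t <= pos s b).
Proof.
elim: b => [|b IHb]; first by rewrite leqn0 => /eqP->; rewrite big_geq.
rewrite leq_eqVlt => /predU1P[->|]; first by rewrite big_geq.
rewrite ltnS => le_ab; rewrite indS big_nat_recr //=.
have := IHb le_ab; move: (\sum_(_ <= i < _) _) => c.
by rewrite /crosses; lia.
Qed.

(* Arcs are read rightwards, so u and v lie on the cyclic arc from i to i + 1. *)
Definition one_sided (k : nat) (s : 'S_k.+1) : Prop :=
  forall i u v : nat, i < k -> v < i -> i.+1 < u <= k ->
    btw (pos s i) (pos s u) (pos s i.+1) ->
    btw (pos s i) (pos s v) (pos s i.+1) -> False.

(** Provides the smaller and the larger letter that [one_sided] forbids on a common arc. *)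
Lemma crosses_btw (k : nat) (s : 'S_k.+1) (i x y : nat) :
  i < k -> x <= k -> y <= k -> pos s y = (pos s x).+1 ->
  crosses s (pos s y) i -> x != i -> y != i.+1 ->
  (x == i.+1) || btw (pos s i) (pos s x) (pos s i.+1)
  /\ (y == i) || btw (pos s i) (pos s y) (pos s i.+1).
Proof.
move=> ik xk yk exy.
have xi := @pos_inj k s x i xk (ltnW ik).
have xi1 := @pos_inj k s x i.+1 xk ik.
have yi := @pos_inj k s y i yk (ltnW ik).
have yi1 := @pos_inj k s y i.+1 yk ik.
have ii1 := @pos_inj k s i i.+1 (ltnW ik) ik.
by rewrite /crosses /btw; lia.
Qed.

Lemma ind_ascent (k : nat) (s : 'S_k.+1) (x y : nat) : one_sided s ->
  x.+1 < y <= k -> pos s y = (pos s x).+1 -> ind s y = (ind s x).+1.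
Proof.
move=> hs /andP[xy yk] exy.
have := @sum_crosses k s (pos s y) x y (ltnW (ltnW xy)).
case: y => // y in xy yk exy *.
(* The first and last arcs are distinct since [x.+1 < y.+1]; their two crossings, less the endpoint
   term of [y.+1], leave 1. *)
rewrite indS (big_nat_recr y x) ?(ltnW (xy : x < y)) //= big_ltn //.
rewrite big_nat_cond big1 => [|i].
  have xy1 := @pos_inj k s x y; have x1y := @pos_inj k s x.+1 y.+1.
  have yy := @pos_inj k s y.+1 y.
  have cx : crosses s (pos s y.+1) x by rewrite /crosses; lia.
  have cy : crosses s (pos s y.+1) y by rewrite /crosses; lia.
  by rewrite cx cy; lia.
rewrite andbT => /andP[xi iy]; apply/eqP; rewrite eqb0; apply/negP => ci.
have [] := crosses_btw _ _ yk exy ci; try lia.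
by move=> bx by_; apply: (hs i y.+1 x); try lia.
Qed.

Lemma ind_descent (k : nat) (s : 'S_k.+1) (x y : nat) : one_sided s ->
  y < x <= k -> pos s y = (pos s x).+1 -> ind s x = (ind s y).+1.
Proof.
move=> hs /andP[yx xk] exy.
have := @sum_crosses k s (pos s y) y x (ltnW yx).
rewrite big_nat_cond big1 => [|i]; first by lia.
rewrite andbT => /andP[yi ix]; apply/eqP; rewrite eqb0; apply/negP => ci.
(* An arc ending at [x] stops before the cut, and one starting at [y] begins after it. *)
have xi1 : x != i.+1.
  apply/negP => /eqP xi1; move: ci; rewrite /crosses -xi1 exy.
  have := @pos_inj k s y i; have := @pos_inj k s x i; lia.
have yi1 : y != i.
  apply/negP => /eqP yi1; move: ci; rewrite /crosses -yi1 exy.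
  have := @pos_inj k s y y.+1; lia.
have [] := crosses_btw _ xk _ exy ci; try lia.
by move=> bx by_; apply: (hs i x y); try lia.
Qed.

Lemma ind_last (k : nat) (s : 'S_k.+1) (x : nat) : one_sided s ->
  pos s 0 = 0 -> x <= k -> pos s x = k -> ind s x = 0.
Proof.
move=> hs p0 xk px.
(* An arc wrapping around below [x] would pass over both the last letter [x] and the first letter
   0. *)
suff: forall j, j <= x -> ind s j = 0 by apply.
elim=> // j IHj jx; rewrite indS IHj ?(ltnW jx) // addn0.
apply/eqP; rewrite eqb0; apply/negP => wj.
have jj := @pos_inj k s j j.+1; have pj := ltn_pos s j.
have xj := @pos_inj k s x j; have xj1 := @pos_inj k s x j.+1.
have j0 := @pos_inj k s j.+1 0.
have ej : j = 0 -> pos s j = 0 by move=> ->.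
have ex : x = j.+1 -> pos s x = pos s j.+1 by move=> ->.
by apply: (hs j x 0); rewrite ?p0 /btw; lia.
Qed.

Lemma dyck_charge_path (n : nat) (s : 'S_(2 * n).+1) :
  one_sided s -> s ord0 = ord0 ->
  (forall i : nat, i < 2 * n -> s (inord i.+1) != (s (inord i)).+1 :> nat) ->
  dyck_path n (charge_path s).
Proof.
move=> hs s0 sincr.
pose h j := (Posz j, Posz (ind s (s (inord j)))).
have -> : charge_path s = [seq h j | j <- iota 0 (2 * n).+1].
  rewrite -val_enum_ord -map_comp; apply: eq_map => i /=.
  by rewrite /h inord_val.
have in0 : inord 0 = ord0 :> 'I_(2 * n).+1 by apply: val_inj; rewrite /= inordK.
have sP i : i <= 2 * n -> pos s (s (inord i)) = i.
  by move=> ik; rewrite pos_perm inordK.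
rewrite /dyck_path /=; apply/and4P; split.
- by rewrite /h in0 s0.
- rewrite path_map; apply/(pathP 0) => i; rewrite size_iota => ik.
  have -> : nth 0 (0 :: iota 1 (2 * n)) i = i.
    by rewrite -[_ :: _]/(iota 0 (2 * n).+1) nth_iota // ltnS ltnW.
  rewrite nth_iota // add1n /= /dyck_step /h /=.
  have e : pos s (s (inord i.+1)) = (pos s (s (inord i))).+1.
    by rewrite !sP // ltnW.
  have := ltn_ord (s (inord i)); have := ltn_ord (s (inord i.+1)).
  have := sincr i ik.
  have := @ind_ascent _ s (s (inord i)) (s (inord i.+1)) hs.
  have := @ind_descent _ s (s (inord i)) (s (inord i.+1)) hs.
  have : s (inord i) != s (inord i.+1) :> nat.
    by apply/eqP => E; move: e; rewrite E; lia.
  move: e; move: (nat_of_ord _) (nat_of_ord _) => x y.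
  rewrite -!pair_eqE /=; lia.
- rewrite last_map.
  have -> : last 0 (iota 1 (2 * n)) = 2 * n.
    by rewrite (last_nth 0) size_iota -[_ :: _]/(iota 0 (2 * n).+1) nth_iota.
  rewrite /h (ind_last hs) //; last by rewrite sP.
  + by have := pos_perm s ord0; rewrite s0.
  + by rewrite -ltnS ltn_ord.
(* Heights are natural numbers by construction. *)
- by rewrite all_map; apply/allP.
Qed.

(** * The cycle in terms of positions *)

Lemma sigma_ofE (k : nat) (C : 'S_k.+1) (hC : C \in IC k.+1) (i : 'I_k.+1) :
  sigma_of hC i = cyc C i.
Proof. by rewrite permE. Qed.

Lemma pos_cyc (k : nat) (C : 'S_k.+1) (hC : C \in IC k.+1) (i : 'I_k.+1) :
  pos (sigma_of hC) (cyc C i) = i.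
Proof. by rewrite -(sigma_ofE hC) pos_perm. Qed.

Lemma cyc_betweenE (k : nat) (C : 'S_k.+1) (hC : C \in IC k.+1)
    (a x b : 'I_k.+1) : let p := pos (sigma_of hC) in
  cyc_between C a x b = btw (p a) (p x) (p b).
Proof.
move=> p; apply/existsP/idP => [[i /existsP[j /existsP[l]]]|hb].
  by case/and4P=> /eqP-> /eqP-> /eqP->; rewrite /p !pos_cyc.
have E (c : 'I_k.+1) : c == cyc C ((sigma_of hC)^-1 c)%g.
  by rewrite -(sigma_ofE hC) permKV.
exists ((sigma_of hC)^-1 a)%g; apply/existsP; exists ((sigma_of hC)^-1 x)%g.
apply/existsP; exists ((sigma_of hC)^-1 b)%g; rewrite !E /=.
by move: hb; rewrite /p /pos !inord_val.
Qed.

Lemma cycS (k : nat) (C : 'S_k.+1) (i : nat) : cyc C i.+1 = C (cyc C i).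
Proof. by rewrite /cyc expgSr permM. Qed.

Lemma cyc_period (k : nat) (C : 'S_k.+1) : full_cycle C -> cyc C k.+1 = ord0.
Proof.
move=> /eqP hC.
have h0 : porbit C ord0 = setT.
  by apply/set1P; rewrite -hC; apply/imsetP; exists ord0.
by have := iter_porbit C ord0; rewrite h0 cardsT card_ord /cyc permX.
Qed.

Lemma pos_succ (k : nat) (C : 'S_k.+1) (hC : C \in IC k.+1) (a : 'I_k.+1) :
  let p := pos (sigma_of hC) in p (C a) = if p a < k then (p a).+1 else 0.
Proof.
move=> p; have [i ->] : exists i : 'I_k.+1, a = cyc C i.
  by exists ((sigma_of hC)^-1 a)%g; rewrite -(sigma_ofE hC) permKV.
rewrite -cycS /p pos_cyc; case: ltnP => [ik|ki].
  by rewrite -[i.+1]/(nat_of_ord (Ordinal (ik : i.+1 < k.+1))) pos_cyc.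
have -> : i = k :> nat by have := ltn_ord i; lia.
rewrite cyc_period ?IC_full_cycle //.
by have := pos_cyc hC ord0; rewrite /cyc expg0 perm1.
Qed.

(** * Counting nontrivial occurrences *)

Lemma nontrivial_occ_larger (k : nat) (C : 'S_k.+1) (hC : C \in IC k.+1)
    (a c u : 'I_k.+1) : c = a.+1 :> nat -> c < u -> cyc_between C a u c ->
  exists2 b : 'I_k.+1, c < b & mu_occ C a b.
Proof.
move=> ec cu bu.
pose P (x : 'I_k.+1) := (c < x) && cyc_between C a x c.
have Pu : P u by rewrite /P cu.
(* Minimality excludes obstructing letters above [c], and [c] itself comes after [b] when reading
   from [a]. *)
case: (arg_minnP (fun x : 'I_k.+1 => x : nat) Pu) => b /andP[cb bb] hmin.
exists b => //; rewrite /mu_occ; apply/andP; split; first by lia.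
apply/forallP => x; apply/implyP => /andP[ax xb]; apply/negP.
have [xc|cx] := leqP x c; last first.
  move=> bx; suff /hmin : P x by lia.
  rewrite /P cx /=; move: bb bx; rewrite !(cyc_betweenE hC) /btw; lia.
have -> : x = c by apply: val_inj => /=; lia.
by move: bb; rewrite !(cyc_betweenE hC) /btw; lia.
Qed.

(** Dual choice: the largest letter below [a] on the arc. *)
Lemma nontrivial_occ_smaller (k : nat) (C : 'S_k.+1) (hC : C \in IC k.+1)
    (a c v : 'I_k.+1) : c = a.+1 :> nat -> v < a -> cyc_between C a v c ->
  exists2 b : 'I_k.+1, b < a & mu_occ C b c.
Proof.
move=> ec va bv.
pose P (x : 'I_k.+1) := (x < a) && cyc_between C a x c.
have Pv : P v by rewrite /P va.
case: (arg_maxnP (fun x : 'I_k.+1 => x : nat) Pv) => b /andP[ba bb] hmax.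
exists b => //; rewrite /mu_occ; apply/andP; split; first by lia.
apply/forallP => x; apply/implyP => /andP[bx xc]; apply/negP.
have [ax|xa] := leqP a x; last first.
  move=> hx; suff /hmax : P x by lia.
  rewrite /P xa /=; move: bb hx; rewrite !(cyc_betweenE hC) /btw; lia.
have -> : x = a by apply: val_inj => /=; lia.
by move: bb; rewrite !(cyc_betweenE hC) /btw; lia.
Qed.

Lemma IC_succ_neq (k : nat) (C : 'S_k.+1) (a : 'I_k.+1) :
  C \in IC k.+1 -> a < k -> C a != a.+1 :> nat.
Proof. by rewrite inE => /andP[_ /forallP/(_ a)/implyP]; apply. Qed.

Lemma IC_one_sided (k : nat) (C : 'S_k.+1) (hC : C \in IC k.+1) :
  (NT_mu C).*2 <= k -> one_sided (sigma_of hC).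
Proof.
rewrite /NT_mu; set S := [set p | _] => hS.
pose A : {set 'I_k.+1} := [set p.1 | p in S].
(* The predecessor is genuine: second components in [S] are positive. *)
pose B : {set 'I_k.+1} := [set inord (p.2 : 'I_k.+1).-1 | p in S].
have inA (a c u : 'I_k.+1) : c = a.+1 :> nat -> c < u ->
    cyc_between C a u c -> a \in A.
  move=> ec cu /(nontrivial_occ_larger hC ec cu)[b cb occ].
  by apply/imsetP; exists (a, b); rewrite // inE occ /= -ec.
have inB (a c v : 'I_k.+1) : c = a.+1 :> nat -> v < a ->
    cyc_between C a v c -> a \in B.
  move=> ec va /(nontrivial_occ_smaller hC ec va)[b ba occ].
  apply/imsetP; exists (b, c); rewrite /= ?ec ?inord_val //.
  by rewrite inE occ /= ec ltnS.
have cardA : #|A| <= #|S| := leq_imset_card _ _.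
have cardB : #|B| <= #|S| := leq_imset_card _ _.
have cover : [set~ ord_max] \subset A :|: B.
  apply/subsetP => a; rewrite !inE -val_eqE /= => ak.
  have {}ak : a < k by have := ltn_ord a; lia.
  pose c : 'I_k.+1 := Ordinal (ak : a.+1 < k.+1).
  have Cac := IC_succ_neq hC ak.
  have pC := pos_succ hC a; rewrite /= in pC.
  have pa := ltn_pos (sigma_of hC) a.
  have pc := ltn_pos (sigma_of hC) a.+1.
  have Cle : C a <= k by rewrite -ltnS ltn_ord.
  have ac := @pos_inj k (sigma_of hC) a a.+1 (ltnW ak) ak.
  have Cc := @pos_inj k (sigma_of hC) (C a) a.+1 Cle ak.
  have Ca := @pos_inj k (sigma_of hC) (C a) a Cle (ltnW ak).
  (* By incontractibility the letter right after [a] lies inside the arc, so it witnesses one of the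
     two cases. *)
  have bC : cyc_between C a (C a) c.
    by rewrite (cyc_betweenE hC) /btw /=; move: pC; case: ifP; lia.
  have nCa : C a != a :> nat.
    apply/eqP => E; move: pC; rewrite E; case: ifP; lia.
  case: (ltngtP (C a) a) => [lt|gt|/eqP]; last by rewrite (negPf nCa).
    by rewrite (inB a c (C a)) ?orbT.
  by rewrite (inA a c (C a)) //= ltn_neqAle eq_sym Cac.
(* The union has at least [k] elements, while the two cardinals add up to at most twice [#|S|],
   hence at most [k]. *)
have AB0 : A :&: B = set0.
  apply/eqP; rewrite -cards_eq0.
  have : k <= #|A :|: B|.
    by have := subset_leq_card cover; rewrite cardsC1 card_ord.
  have := cardsUI A B; lia.
move=> i u v ik vi /andP[iu uk] bu bv.
pose a : 'I_k.+1 := inord i; pose c : 'I_k.+1 := inord i.+1.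
have ea : a = i :> nat by rewrite inordK // ltnW.
have ec : c = i.+1 :> nat by rewrite inordK.
suff: a \in A :&: B by rewrite AB0 inE.
have eu : (inord u : 'I_k.+1) = u :> nat by rewrite inordK.
have ev : (inord v : 'I_k.+1) = v :> nat by rewrite inordK; lia.
rewrite inE (inA a c (inord u)) ?(inB a c (inord v)) ?ea ?ec ?eu ?ev //;
  by rewrite (cyc_betweenE hC) ?ea ?ec ?eu ?ev.
Qed.

Theorem theorem9 (n : nat) (hn : 1 <= n) (C : 'S_(2 * n).+1)
    (hC : C \in IC (2 * n).+1) (hNT : NT_mu C = n) :
  dyck_path n (charge_path (sigma_of hC)).
Proof.
apply: dyck_charge_path => [||i ik].
- by apply: IC_one_sided; rewrite hNT mul2n.
- by rewrite sigma_ofE /cyc expg0 perm1.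
- have ile := ltnW ik; rewrite !sigma_ofE !inordK // cycS.
  (* After the largest letter, the inequality holds because no letter exceeds [2 * n]. *)
  case: (ltnP (cyc C i) (2 * n)) => [|h]; first exact: IC_succ_neq.
  by have := ltn_ord (C (cyc C i)); lia.
Qed.
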